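(* Let $\mathscr{X}=(\mathcal{X}_t,\alpha^{s\to t},\beta^{t\to s})$ be a vineyard module over $[s_0,s_1]$ with vine and matrix representation $(\{\gamma_i\},\{M(\alpha^{s\to t})\},\{M(\beta^{t\to s})\})$. Suppose that for all $s_0\le s<t\le s_1$ both $M(\alpha^{s\to t})$ and $M(\beta^{t\to s})$ are block diagonal with block index sets $S_1,S_2,\dots,S_m$ (a fixed partition of the index set of the vines, the same for all $s,t$). Then there are vineyard modules $\mathscr{X}_1,\dots,\mathscr{X}_m$ with $\mathscr{X}\cong\bigoplus_{j=1}^m\mathscr{X}_j$, where $\mathscr{X}_j$ has vine and matrix representation $$(\{\gamma_i\mid i\in S_j\},\{\pi_{S_j}(M(\alpha^{s\to t}))\},\{\pi_{S_j}(M(\beta^{t\to s}))\}),$$ and $\pi_{S_j}(A)$ denotes the restriction of the matrix $A$ to the coordinates (rows and columns) in $S_j$.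
   Context: Fix a field. A persistence module $\mathcal{X}$ is a family of vector spaces $(X_h)_{h\in\mathbb{R}}$ with transition maps $\phi_g^h:X_g\to X_h$ for $g\le h$, $\phi_h^h=\mathrm{id}$, $\phi_g^h\phi_f^g=\phi_f^h$. All persistence modules are assumed isomorphic to $\bigoplus_{i=1}^N\mathcal{I}[b_i,d_i)$ (interval modules) with $N$ finite, $b_i$ finite and the intervals pairwise distinct. An $\epsilon$-morphism $\alpha:\mathcal{X}\to\mathcal{Y}$ is a family of linear maps $\alpha_h:X_h\to Y_{h+\epsilon}$ commuting with transition maps; a morphism is a $0$-morphism; an $\epsilon$-interleaving is a pair of $\epsilon$-morphisms $\alpha:\mathcal{X}\to\mathcal{Y}$, $\beta:\mathcal{Y}\to\mathcal{X}$ whose composites (both orders) are the transition maps shifting height by $2\epsilon$. A (1-Lipschitz) vineyard module over $[s_0,s_1]$ is a family of persistence modules $\{\mathcal{X}_t\}_{t\in[s_0,s_1]}$ with, for each $s<t$, a $|s-t|$-interleaving $\alpha^{s\to t}:\mathcal{X}_s\to\mathcal{X}_t$, $\beta^{t\to s}:\mathcal{X}_t\to\mathcal{X}_s$, such that all interleaving maps commute with each other and with the transition maps. A morphism of vineyard modules is a family of morphisms of persistence modules, one for each time, commuting with all interleaving and transition maps; direct sums are taken timewise on persistence modules and on interleaving maps. The underlying vineyard is the path of persistence diagrams of $\mathcal{X}_t$ (continuous for the bottleneck distance). A vine is such a path with at most one off-diagonal point at each time, whose support (the set of times with an off-diagonal point) is a nonempty interval. Since no diagram has points of multiplicity $\ge2$,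 the vineyard is uniquely a union of vines; it is assumed that there are finitely many vines $\gamma_1,\dots,\gamma_N$, finitely many times at which births and deaths are not all distinct, and that at each such time at most one pair of birth/death values coincides. Write $\gamma_i(t)=(\mathbf{b}(\gamma_i(t)),\mathbf{d}(\gamma_i(t)))$ for $t\in\operatorname{supp}(\gamma_i)$. For $x\in X_h$, $\mathbf{b}(x)=h$ if $x$ is not in the image of $\phi_g^h$ for any $g<h$; then $\mathbf{d}(x)=\inf\{g>\mathbf{b}(x):\phi_{\mathbf{b}(x)}^g(x)=0\}$. A basis of $\mathcal{X}\cong\bigoplus_i\mathcal{I}[b_i,d_i)$ is a set $\{x_i\}$ with $x_i\in X_{b_i}$, $\mathbf{b}(x_i)=b_i$, $\mathbf{d}(x_i)=d_i$, such that for each $h$ the set $\{\phi_{b_i}^h(x_i):b_i\le h<d_i\}$ is a basis of $X_h$. An extended basis is a basis together with an indexed set of zero elements. For an $\epsilon$-morphism $\alpha:\mathcal{X}\to\mathcal{Y}$ and bases $B_X=\{x_i\}$, $B_Y=\{y_j\}$, $\mathrm{Mat}_{B_X}^{B_Y}(\alpha)$ is defined by $\alpha(x_i)=\sum_j\mathrm{Mat}_{B_X}^{B_Y}(\alpha)(j,i)\,\psi_{\mathbf{b}(y_j)}^{\mathbf{b}(x_i)+\epsilon}(y_j)$, summing over $j$ with $\mathbf{b}(y_j)\le\mathbf{b}(x_i)+\epsilon<\mathbf{d}(y_j)$ ($\psi$ the transition maps of $\mathcal{Y}$), all other entries being $0$; rows and columns of zero elements of extended bases are zero. A vine and matrix representation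 of $\mathscr{X}$ consists of its set of vines $\{\gamma_1,\dots,\gamma_N\}$ and families of matrices $\{M(\alpha^{s\to t})\mid s_0\le s<t\le s_1\}$ and $\{M(\beta^{t\to s})\mid s_0\le s<t\le s_1\}$ such that there exists a family of extended bases $B_t=\{x_1^t,\dots,x_N^t\}$ of $\mathcal{X}_t$ respecting the order of the vines ($x_i^t$ has birth $\mathbf{b}(\gamma_i(t))$ and death $\mathbf{d}(\gamma_i(t))$ if $t\in\operatorname{supp}(\gamma_i)$, and $x_i^t=0$ otherwise) with $M(\alpha^{s\to t})=\mathrm{Mat}_{B_s}^{B_t}(\alpha^{s\to t})$ and $M(\beta^{t\to s})=\mathrm{Mat}_{B_t}^{B_s}(\beta^{t\to s})$ for all $s<t$. *)

(* Defs.v *)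
From HB Require Import structures.
From mathcomp Require Import all_boot all_order all_algebra.
From mathcomp Require Import all_classical all_reals all_analysis.

Set Implicit Arguments.
Unset Strict Implicit.
Unset Printing Implicit Defensive.

Import Order.TTheory GRing.Theory Num.Theory.
Local Open Scope classical_set_scope.
Local Open Scope ring_scope.

Section FiniteDirectSum.
Variables (K : fieldType) (I : finType).

Definition dsum (V : I -> lmodType K) : Type := {dffun forall i, V i}.

Section Instances.
Variable V : I -> lmodType K.
Implicit Types u v w : dsum V.

HB.instance Definition _ := Choice.copy (dsum V) {dffun forall i, V i}.

Definition dsum_zero : dsum V := [ffun i => 0 : V i].
Definition dsum_opp u : dsum V := [ffun i => - u i].
Definition dsum_add u v : dsum V := [ffun i => u i + v i].
Definition dsum_scale (a : K) u : dsum V := [ffun i => a *: u i].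

Lemma dsum_addA : associative dsum_add.
Proof. by move=> u v w; apply/ffunP=> i; rewrite !ffunE addrA. Qed.

Lemma dsum_addC : commutative dsum_add.
Proof. by move=> u v; apply/ffunP=> i; rewrite !ffunE addrC. Qed.

Lemma dsum_add0 : left_id dsum_zero dsum_add.
Proof. by move=> u; apply/ffunP=> i; rewrite !ffunE add0r. Qed.

Lemma dsum_addN : left_inverse dsum_zero dsum_opp dsum_add.
Proof. by move=> u; apply/ffunP=> i; rewrite !ffunE addNr. Qed.

HB.instance Definition _ :=
  GRing.isZmodule.Build (dsum V) dsum_addA dsum_addC dsum_add0 dsum_addN.

Lemma dsum_scaleA a b u : dsum_scale a (dsum_scale b u) = dsum_scale (a * b) u.
Proof. by apply/ffunP=> i; rewrite !ffunE scalerA. Qed.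

Lemma dsum_scale1 : left_id 1 dsum_scale.
Proof. by move=> u; apply/ffunP=> i; rewrite !ffunE scale1r. Qed.

Lemma dsum_scaleDr : right_distributive dsum_scale +%R.
Proof. by move=> a u v; apply/ffunP=> i; rewrite !ffunE scalerDr. Qed.

Lemma dsum_scaleDl u : {morph dsum_scale^~ u : a b / a + b}.
Proof. by move=> a b; apply/ffunP=> i; rewrite !ffunE scalerDl. Qed.

HB.instance Definition _ := GRing.Zmodule_isLmodule.Build K (dsum V)
  dsum_scaleA dsum_scale1 dsum_scaleDr dsum_scaleDl.

End Instances.

Definition dsum_map (V W : I -> lmodType K) (f : forall i, {linear V i -> W i})
  (u : dsum V) : dsum W := [ffun i => f i (u i)].

Lemma dsum_map_linear (V W : I -> lmodType K)
    (f : forall i, {linear V i -> W i}) :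
  linear (dsum_map f).
Proof. by move=> a u v; apply/ffunP=> i; rewrite !ffunE linearP. Qed.

HB.instance Definition _ (V W : I -> lmodType K)
    (f : forall i, {linear V i -> W i}) :=
  GRing.isLinear.Build K (dsum V) (dsum W) *:%R (dsum_map f)
    (dsum_map_linear f).

End FiniteDirectSum.

Section PersistenceModules.
Variables (R : realType) (K : fieldType).

(* [pm_tr g h] is the transition map X_g -> X_h. It is a total family for
   convenience: only its members with g <= h are meaningful, and those with
   h < g are never constrained nor used. *)
Record pmod := PMod {
  pm_sp :> R -> lmodType K;
  pm_tr : forall g h, {linear pm_sp g -> pm_sp h};
  pm_tr_id : forall h x, pm_tr h h x = x;
  pm_tr_comp : forall f g h, f <= g -> g <= h ->
    forall x, pm_tr g h (pm_tr f g x) = pm_tr f h x }.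

Record pm_hom (X Y : pmod) := PMHom {
  pm_map :> forall h, {linear X h -> Y h};
  pm_map_tr : forall g h, g <= h ->
    forall x, pm_map h (pm_tr X g h x) = pm_tr Y g h (pm_map g x) }.

Definition pm_iso (X Y : pmod) : Prop :=
  exists (f : pm_hom X Y) (g : pm_hom Y X),
    (forall h x, g h (f h x) = x) /\ (forall h y, f h (g h y) = y).

Record eps_mor (e : R) (X Y : pmod) := EpsMor {
  em_map :> forall h, {linear X h -> Y (h + e)};
  em_map_tr : forall g h, g <= h ->
    forall x, em_map h (pm_tr X g h x) = pm_tr Y (g + e) (h + e) (em_map g x) }.

Definition interleaving (e : R) (X Y : pmod)
    (al : eps_mor e X Y) (be : eps_mor e Y X) : Prop :=
  (forall h x, be (h + e) (al h x) = pm_tr X h (h + e + e) x) /\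
  (forall h y, al (h + e) (be h y) = pm_tr Y h (h + e + e) y).

(* The composite of [al] and [be] is [ga] followed by a transition map; only
   used when e <= e1 + e2. *)
Definition commute_via (e1 e2 e : R) (X Y Z : pmod)
    (al : eps_mor e1 X Y) (be : eps_mor e2 Y Z) (ga : eps_mor e X Z) : Prop :=
  forall h x, be (h + e1) (al h x) = pm_tr Z (h + e) (h + e1 + e2) (ga h x).

Section Sum.
Variables (I : finType) (X : I -> pmod).

Definition psum_tr g h :
    {linear dsum (fun i => X i g) -> dsum (fun i => X i h)} :=
  dsum_map (fun i => pm_tr (X i) g h).

Lemma psum_tr_id h x : psum_tr h h x = x.
Proof. by apply/ffunP=> i; rewrite !ffunE pm_tr_id. Qed.

Lemma psum_tr_comp f g h : f <= g -> g <= h ->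
  forall x, psum_tr g h (psum_tr f g x) = psum_tr f h x.
Proof. by move=> fg gh x; apply/ffunP=> i; rewrite !ffunE pm_tr_comp. Qed.

Definition psum : pmod := PMod psum_tr_id psum_tr_comp.

End Sum.

Section EpsSum.
Variables (I : finType) (X Y : I -> pmod) (e : R).
Variable al : forall i, eps_mor e (X i) (Y i).

Definition esum_map h : {linear psum X h -> psum Y (h + e)} :=
  dsum_map (fun i => al i h).

Lemma esum_map_tr g h : g <= h -> forall x,
  esum_map h (pm_tr (psum X) g h x) = pm_tr (psum Y) (g + e) (h + e) (esum_map g x).
Proof. by move=> gh x; apply/ffunP=> i; rewrite !ffunE em_map_tr. Qed.

Definition eps_sum : eps_mor e (psum X) (psum Y) := EpsMor esum_map_tr.

End EpsSum.

Definition dpoint : Type := (R * \bar R)%type.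

(* The boolean [b <= h < d] is read as a dimension, so the space at h is K (row
   vectors of length 1) for h in [b, d) and 0 otherwise, and a transition map is
   the 1 x 1 identity matrix or an empty matrix. *)
Section Interval.
Variable p : dpoint.

Definition in_itv (h : R) : bool := (p.1 <= h) && (h%:E < p.2)%E.

Definition itv_tr g h : {linear 'rV[K]_(in_itv g) -> 'rV[K]_(in_itv h)} :=
  mulmxr (const_mx 1).

Lemma itv_tr_id h x : itv_tr h h x = x.
Proof.
rewrite /itv_tr; case: (in_itv h) x => x; last by apply/matrixP=> i [].
by apply/matrixP=> i j; rewrite !mxE big_ord1 mxE mulr1 (ord1 j).
Qed.

Lemma itv_tr_comp f g h : f <= g -> g <= h ->
  forall x, itv_tr g h (itv_tr f g x) = itv_tr f h x.
Proof.
move=> fg gh; rewrite /itv_tr.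
have : in_itv f -> in_itv h -> in_itv g.
  move=> /andP[bf _] /andP[_ hd]; rewrite /in_itv (le_trans bf fg) /=.
  by apply: le_lt_trans hd; rewrite lee_fin.
case: (in_itv f); last by move=> _ x; rewrite (thinmx0 x) !linear0.
case: (in_itv h); last by move=> _ x; apply/matrixP=> i [].
move=> /(_ isT isT); case: (in_itv g) => // _ x.
apply/matrixP=> i j; rewrite !mxE !big_ord1 !mxE !mulr1 !big_ord1 !mxE mulr1.
by [].
Qed.

Definition itv_mod : pmod := @PMod (fun h => 'rV[K]_(in_itv h)) itv_tr
  itv_tr_id itv_tr_comp.

End Interval.

(* [D] lists the off-diagonal points of the persistence diagram of [X]; by
   convention no diagram has a point of multiplicity >= 2. *)
Definition has_diagram (X : pmod) (D : seq dpoint) : Prop :=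
  [/\ forall p, p \in D -> (p.1%:E < p.2)%E,
      uniq D &
      pm_iso X (psum (fun i : 'I_(size D) => itv_mod (tnth (in_tuple D) i)))].

(* l^oo distance, where two infinite deaths are at distance 0. *)
Definition point_dist (p q : dpoint) : \bar R :=
  maxe (`|p.1 - q.1|%:E)%E (if p.2 == q.2 then 0 else `|p.2 - q.2|)%E.

Definition diagonal_dist (p : dpoint) : \bar R :=
  ((p.2 - p.1%:E) * (2^-1)%:E)%E.

(* A matching is a partial injection between off-diagonal points; unmatched
   points are sent to the diagonal. *)
Definition matching (D E : seq dpoint)
    (f : {ffun 'I_(size D) -> option 'I_(size E)}) : Prop :=
  forall i j k, f i = Some k -> f j = Some k -> i = j.

Definition matching_cost (D E : seq dpoint)
    (f : {ffun 'I_(size D) -> option 'I_(size E)}) : \bar R :=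
  maxe
    (\big[maxe/0%E]_(i < size D)
      if f i is Some k
      then point_dist (tnth (in_tuple D) i) (tnth (in_tuple E) k)
      else diagonal_dist (tnth (in_tuple D) i))
    (\big[maxe/0%E]_(k < size E | [forall i, f i != Some k])
      diagonal_dist (tnth (in_tuple E) k)).

Definition bottleneck (D E : seq dpoint) : \bar R :=
  ereal_inf [set matching_cost f | f in [set f | @matching D E f]].

Section Bases.
Variable X : pmod.

Definition elt : Type := {h : R & X h}.

Definition push (x : elt) (h : R) : X h := pm_tr X (tag x) h (tagged x).

Definition has_birth (x : elt) (b : R) : Prop :=
  tag x = b /\ forall g, g < tag x -> ~ exists y, pm_tr X g (tag x) y = tagged x.

Definition death (x : elt) : \bar R :=
  ereal_inf [set g%:E | g in [set g | tag x < g /\ push x g = 0]].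

Definition alive (x : elt) (h : R) : bool :=
  (tag x <= h) && (h%:E < death x)%E.

End Bases.

Definition is_basis (V : lmodType K) (I : finType) (P : pred I) (e : I -> V) :=
  (forall c : I -> K, \sum_(i | P i) c i *: e i = 0 -> forall i, P i -> c i = 0)
  /\ (forall v : V, exists c : I -> K, v = \sum_(i | P i) c i *: e i).

(* The index i carries a basis element with the birth and death of [D i] if
   [D i] is a point, and a zero element (at an arbitrary height) otherwise. *)
Definition extended_basis (X : pmod) (N : nat) (D : 'I_N -> option dpoint)
    (x : 'I_N -> elt X) : Prop :=
  (forall i, if D i is Some p then has_birth (x i) p.1 /\ death (x i) = p.2
             else tagged (x i) = 0)
  /\ (forall h, is_basis (fun i => D i && alive (x i) h)
                         (fun i => push (x i) h)).

(* [A] is the matrix of [al]; columns are indexed by the source basis. *)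
Definition is_Mat (e : R) (X Y : pmod) (N : nat) (x : 'I_N -> elt X)
    (y : 'I_N -> elt Y) (al : eps_mor e X Y) (A : 'M[K]_N) : Prop :=
  let entry j i := [&& tagged (x i) != 0, tagged (y j) != 0
                     & alive (y j) (tag (x i) + e)] in
  (forall i, al (tag (x i)) (tagged (x i)) =
     \sum_(j | entry j i) A j i *: push (y j) (tag (x i) + e))
  /\ (forall j i, ~~ entry j i -> A j i = 0).

End PersistenceModules.

Section VineyardModules.
Variables (R : realType) (s0 s1 : R).

Definition time : Type := {t : R | s0 <= t <= s1}.

Definition before (s t : time) : Prop := sval s < sval t.

Definition gap (s t : time) : R := `|sval s - sval t|.

Section Fixed_field.
Variable K : fieldType.

(* [vm_alpha s t] and [vm_beta s t] are alpha^{s->t} and beta^{t->s}. The last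
   two fields list all the triangles of interleaving maps over s < t < u. *)
Record vineyard_module := VineyardModule {
  vm_at :> time -> pmod R K;
  vm_alpha : forall s t, before s t -> eps_mor (gap s t) (vm_at s) (vm_at t);
  vm_beta : forall s t, before s t -> eps_mor (gap s t) (vm_at t) (vm_at s);
  vm_interleaving : forall s t (st : before s t),
    interleaving (vm_alpha st) (vm_beta st);
  vm_functorial : forall s t u
      (st : before s t) (tu : before t u) (su : before s u),
    commute_via (vm_alpha st) (vm_alpha tu) (vm_alpha su) /\
    commute_via (vm_beta tu) (vm_beta st) (vm_beta su);
  vm_mixed : forall s t u
      (st : before s t) (tu : before t u) (su : before s u),
    [/\ commute_via (vm_beta st) (vm_alpha su) (vm_alpha tu),
        commute_via (vm_alpha su) (vm_beta tu) (vm_alpha st),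
        commute_via (vm_beta su) (vm_alpha st) (vm_beta tu) &
        commute_via (vm_alpha tu) (vm_beta su) (vm_beta st)] }.

Record vm_hom (X Y : vineyard_module) := VMHom {
  vm_map :> forall t, pm_hom (X t) (Y t);
  vm_map_alpha : forall s t (st : before s t) h x,
    vm_map t (h + gap s t) (vm_alpha X st h x) = vm_alpha Y st h (vm_map s h x);
  vm_map_beta : forall s t (st : before s t) h x,
    vm_map s (h + gap s t) (vm_beta X st h x) = vm_beta Y st h (vm_map t h x) }.

Definition vm_iso (X Y : vineyard_module) : Prop :=
  exists (f : vm_hom X Y) (g : vm_hom Y X),
    (forall t h x, g t h (f t h x) = x) /\ (forall t h y, f t h (g t h y) = y).

Section Sum.
Variables (I : finType) (X : I -> vineyard_module).

Definition vsum_at t := psum (fun i => X i t).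

Definition vsum_alpha s t (st : before s t) :
    eps_mor (gap s t) (vsum_at s) (vsum_at t) :=
  eps_sum (fun i => vm_alpha (X i) st).

Definition vsum_beta s t (st : before s t) :
    eps_mor (gap s t) (vsum_at t) (vsum_at s) :=
  eps_sum (fun i => vm_beta (X i) st).

Lemma eps_sum_commute (e1 e2 e : R) (A B C : I -> pmod R K)
    (al : forall i, eps_mor e1 (A i) (B i))
    (be : forall i, eps_mor e2 (B i) (C i))
    (ga : forall i, eps_mor e (A i) (C i)) :
  (forall i, commute_via (al i) (be i) (ga i)) ->
  commute_via (eps_sum al) (eps_sum be) (eps_sum ga).
Proof. by move=> H h x; apply/ffunP=> i; rewrite !ffunE H. Qed.

Lemma vsum_interleaving s t (st : before s t) :
  interleaving (vsum_alpha st) (vsum_beta st).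
Proof.
split=> h x; apply/ffunP=> i; rewrite !ffunE;
  by case: (vm_interleaving (X i) st) => H1 H2; rewrite ?H1 ?H2.
Qed.

Lemma vsum_functorial s t u
    (st : before s t) (tu : before t u) (su : before s u) :
  commute_via (vsum_alpha st) (vsum_alpha tu) (vsum_alpha su) /\
  commute_via (vsum_beta tu) (vsum_beta st) (vsum_beta su).
Proof.
by split; apply: eps_sum_commute => i; case: (vm_functorial (X i) st tu su).
Qed.

Lemma vsum_mixed s t u
    (st : before s t) (tu : before t u) (su : before s u) :
  [/\ commute_via (vsum_beta st) (vsum_alpha su) (vsum_alpha tu),
      commute_via (vsum_alpha su) (vsum_beta tu) (vsum_alpha st),
      commute_via (vsum_beta su) (vsum_alpha st) (vsum_beta tu) &
      commute_via (vsum_alpha tu) (vsum_beta su) (vsum_beta st)].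
Proof.
by split; apply: eps_sum_commute => i; case: (vm_mixed (X i) st tu su).
Qed.

Definition vsum : vineyard_module :=
  VineyardModule vsum_interleaving vsum_functorial vsum_mixed.

End Sum.
End Fixed_field.

Definition diagram_of_option (p : option (dpoint R)) : seq (dpoint R) :=
  if p is Some q then [:: q] else [::].

Definition continuous_path (D : time -> seq (dpoint R)) : Prop :=
  forall t (e : R), 0 < e -> exists2 d : R, 0 < d &
    forall u, `|sval u - sval t| < d -> (bottleneck (D t) (D u) < e%:E)%E.

Definition supp (g : time -> option (dpoint R)) : set R :=
  [set sval t | t in [set t | g t]].

Record vine := Vine {
  vine_path :> time -> option (dpoint R);
  vine_off_diagonal : forall t p, vine_path t = Some p -> (p.1%:E < p.2)%E;
  vine_continuous : continuous_path (fun t => diagram_of_option (vine_path t));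
  vine_supp_neq0 : supp vine_path !=set0;
  vine_supp_itv : is_interval (supp vine_path) }.

Definition vines_diagram (N : nat) (gamma : 'I_N -> vine) (t : time) :
  seq (dpoint R) := pmap (fun i => gamma i t) (enum 'I_N).

(* Deaths equal to +oo are not death values: classes that never die do not
   count as having coinciding deaths. *)
Definition critical_values (D : seq (dpoint R)) : seq (\bar R) :=
  [seq p.1%:E%E | p <- D] ++ [seq p.2 | p <- D & p.2 \is a fin_num].

Definition coincidences (v : seq (\bar R)) : {set 'I_(size v) * 'I_(size v)} :=
  [set ij : 'I_(size v) * 'I_(size v) |
    (ij.1 < ij.2)%N && (tnth (in_tuple v) ij.1 == tnth (in_tuple v) ij.2)]%SET.

(* [gamma] is the set of vines of [X]; this includes the standing assumptions
   that each X_t is a finite sum of pairwise distinct interval modules and that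
   births and deaths are generic. *)
Definition has_vines (K : fieldType) (X : vineyard_module K) (N : nat)
    (gamma : 'I_N -> vine) : Prop :=
  let values t := critical_values (vines_diagram gamma t) in
  [/\ forall t, has_diagram (X t) (vines_diagram gamma t),
      finite_set [set t | ~~ uniq (values t)] &
      forall t, (#|coincidences (values t)| <= 1)%N].

(* The families are indexed by all pairs of times; only s < t is meaningful. *)
Definition vine_matrix_rep (K : fieldType) (X : vineyard_module K) (N : nat)
    (gamma : 'I_N -> vine) (Malpha Mbeta : time -> time -> 'M[K]_N) : Prop :=
  has_vines X gamma /\
  exists B : forall t, 'I_N -> elt (X t),
    (forall t, extended_basis (fun i => gamma i t) (B t)) /\
    (forall s t (st : before s t),
       is_Mat (B s) (B t) (vm_alpha X st) (Malpha s t) /\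
       is_Mat (B t) (B s) (vm_beta X st) (Mbeta s t)).

End VineyardModules.

Definition block_diagonal (K : fieldType) (N m : nat) (S : 'I_m -> {set 'I_N})
    (A : 'M[K]_N) : Prop :=
  forall j1 j2, j1 != j2 -> forall i1 i2, i1 \in S j1 -> i2 \in S j2 ->
    A i1 i2 = 0.

(* Restriction to the rows and columns in [S], renumbered increasingly. *)
Definition restrict_mx (K : fieldType) (N : nat) (S : {set 'I_N})
    (A : 'M[K]_N) : 'M[K]_#|S| :=
  mxsub (@enum_val _ (mem S)) (@enum_val _ (mem S)) A.

(* Main.v *)
Require Import Defs.
From HB Require Import structures.
From mathcomp Require Import all_boot all_order all_algebra.
From mathcomp Require Import all_classical all_reals all_analysis.

Set Implicit Arguments.
Unset Strict Implicit.
Unset Printing Implicit Defensive.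

Import Order.TTheory GRing.Theory Num.Theory.
Local Open Scope ring_scope.

(** Let x_i^t be the given extended bases. For each block S_j, let p_j be the
    projection of X_t (h) onto the span of the images of the x_i^t with i in S_j
    along the span of the others. It commutes with the transition maps because
    the image of a basis element is again a basis element or, from its death on,
    zero; it commutes with the interleaving maps because their matrices are
    block diagonal. So the p_j are endomorphisms of the vineyard module: they
    are orthogonal idempotents with sum 1, and X is the direct sum of the
    vineyard modules X_j of fixed points of p_j. The x_i^t with i in S_j form an
    extended basis of X_j at time t, which gives both the interval
    decomposition and the restricted matrices. *)

(** * Submodules of fixed points *)

Section FixedSubmodule.
Variables (K : fieldType) (V : lmodType K) (p : {linear V -> V}).

Definition fixed_by : {pred V} := [pred x | p x == x].

Lemma fixed_by_submod_closed : submod_closed fixed_by.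
Proof.
split=> [|a u v]; rewrite !inE ?linear0 // => /eqP pu /eqP pv.
by rewrite linearP pu pv.
Qed.

HB.instance Definition _ :=
  GRing.isSubmodClosed.Build K V fixed_by fixed_by_submod_closed.

(** The fixed points are made into a type of their own because the spaces of a persistence module
    are [lmodType]s, not subspaces of an ambient space. *)
Record fix_sub : predArgType := FixSub {
  fix_val :> V;
  _ : fix_val \in fixed_by }.

HB.instance Definition _ := [isSub for fix_val].
HB.instance Definition _ := [Choice of fix_sub by <:].
HB.instance Definition _ := [SubChoice_isSubLmodule of fix_sub by <:].

Lemma fix_valP (u : fix_sub) : p (val u) = val u.
Proof. exact/eqP/(valP u). Qed.

End FixedSubmodule.

Section FixedMap.
Variables (K : fieldType) (V W : lmodType K).
Variables (p : {linear V -> V}) (q : {linear W -> W}) (f : {linear V -> W}).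
Hypothesis qf : forall x, q (f x) = f (p x).

Lemma fix_map_subproof (u : fix_sub p) : f (val u) \in fixed_by q.
Proof. by rewrite inE qf fix_valP. Qed.

Definition fix_map (u : fix_sub p) : fix_sub q := FixSub (fix_map_subproof u).

Lemma fix_map_linear : linear fix_map.
Proof. by move=> a u v; apply: val_inj; rewrite /= linearP. Qed.

HB.instance Definition _ :=
  GRing.isLinear.Build K (fix_sub p) (fix_sub q) *:%R fix_map fix_map_linear.

End FixedMap.

Section InverseLinear.
Variables (K : fieldType) (V W : lmodType K) (f : {linear V -> W}).
Hypotheses (f_inj : injective f) (f_surj : forall y, exists x, f x = y).

Lemma linear_inverse :
  exists g : {linear W -> V}, cancel g f /\ cancel f g.
Proof.
pose g y := projT1 (cid (f_surj y)).
have gK : cancel g f by move=> y; exact: projT2 (cid (f_surj y)).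
have fK : cancel f g by move=> x; apply: f_inj; rewrite gK.
pose L := GRing.isLinear.Build K W V *:%R g (can2_linear fK gK).
pose gL : {linear W -> V} := HB.pack g L.
by exists gL.
Qed.

End InverseLinear.

(** * Isomorphisms and fixed points of persistence and vineyard modules *)

Section PersistenceModuleLemmas.
Variables (R : realType) (K : fieldType).

(** The inverses at the single heights are linear, and they commute with the transition maps because
    this may be checked after applying the injective [f]. *)
Lemma pm_iso_of_bij (X Y : pmod R K) (f : pm_hom Y X) :
    (forall h, injective (f h)) -> (forall h x, exists y, f h y = x) ->
  exists g : pm_hom X Y, (forall h, cancel (g h) (f h)) /\
                         (forall h, cancel (f h) (g h)).
Proof.
move=> f_inj f_surj.
pose g h := projT1 (cid (linear_inverse (@f_inj h) (f_surj h))).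
have gP h : cancel (g h) (f h) /\ cancel (f h) (g h).
  exact: projT2 (cid (linear_inverse (@f_inj h) (f_surj h))).
have gK h := (gP h).1; have fK h := (gP h).2.
have g_tr a b : a <= b ->
    forall x, g b (pm_tr X a b x) = pm_tr Y a b (g a x).
  by move=> ab x; apply: (f_inj b); rewrite pm_map_tr // !gK.
by exists (PMHom g_tr).
Qed.

Lemma vm_iso_of_bij (s0 s1 : R) (X Y : vineyard_module s0 s1 K)
    (f : vm_hom Y X) :
    (forall t h, injective (f t h)) ->
    (forall t h x, exists y, f t h y = x) ->
  vm_iso X Y.
Proof.
move=> f_inj f_surj.
pose g t := projT1 (cid (pm_iso_of_bij (f_inj t) (f_surj t))).
have gP t : (forall h, cancel (g t h) (f t h)) /\
            (forall h, cancel (f t h) (g t h)).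
  exact: projT2 (cid (pm_iso_of_bij (f_inj t) (f_surj t))).
have gK t h := (gP t).1 h; have fK t h := (gP t).2 h.
have g_alpha s t (st : before s t) h x :
    g t (h + gap s t) (vm_alpha X st h x) = vm_alpha Y st h (g s h x).
  by apply: (f_inj t); rewrite vm_map_alpha !gK.
have g_beta s t (st : before s t) h x :
    g s (h + gap s t) (vm_beta X st h x) = vm_beta Y st h (g t h x).
  by apply: (f_inj s); rewrite vm_map_beta !gK.
by exists (VMHom g_alpha g_beta), f; split=> t h x; rewrite ?gK ?fK.
Qed.

Section FixedPersistenceModule.
Variables (X : pmod R K) (p : pm_hom X X).

(* The value [0] for [h < g] is junk: [p] only commutes with [pm_tr X g h] when
   [g <= h]. *)
Definition fix_tr g h : {linear fix_sub (p g) -> fix_sub (p h)} :=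
  if pselect (g <= h) is left gh then fix_map (pm_map_tr p gh) else \0.

Lemma val_fix_tr g h (u : fix_sub (p g)) : g <= h ->
  val (fix_tr g h u) = pm_tr X g h (val u).
Proof. by rewrite /fix_tr; case: pselect. Qed.

Lemma fix_tr_id h (u : fix_sub (p h)) : fix_tr h h u = u.
Proof. by apply: val_inj; rewrite val_fix_tr // pm_tr_id. Qed.

Lemma fix_tr_comp a b c : a <= b -> b <= c ->
  forall u : fix_sub (p a), fix_tr b c (fix_tr a b u) = fix_tr a c u.
Proof.
move=> ab bc u; apply: val_inj.
by rewrite !val_fix_tr ?(le_trans ab) // pm_tr_comp.
Qed.

Definition fix_pmod : pmod R K :=
  @PMod R K (fun h => fix_sub (p h)) fix_tr fix_tr_id fix_tr_comp.

End FixedPersistenceModule.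

Section FixedEpsMor.
Variables (X Y : pmod R K) (p : pm_hom X X) (q : pm_hom Y Y).
Variables (e : R) (al : eps_mor e X Y).
Hypothesis qal : forall h x, q (h + e) (al h x) = al h (p h x).

Definition fix_em_map h : {linear fix_pmod p h -> fix_pmod q (h + e)} :=
  fix_map (@qal h).

Lemma fix_em_tr g h : g <= h -> forall u,
  fix_em_map h (pm_tr (fix_pmod p) g h u) =
  pm_tr (fix_pmod q) (g + e) (h + e) (fix_em_map g u).
Proof.
move=> gh u; apply: val_inj.
by rewrite [RHS]val_fix_tr ?lerD2r //= [in LHS]val_fix_tr // em_map_tr.
Qed.

Definition fix_em : eps_mor e (fix_pmod p) (fix_pmod q) := EpsMor fix_em_tr.

End FixedEpsMor.

Section FixedVineyardModule.
Variables (s0 s1 : R) (X : vineyard_module s0 s1 K) (p : vm_hom X X).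

Definition fix_alpha s t (st : before s t) := fix_em (vm_map_alpha p st).
Definition fix_beta s t (st : before s t) := fix_em (vm_map_beta p st).

Lemma gap_ge0 (s t : time s0 s1) : 0 <= gap s t.
Proof. exact: normr_ge0. Qed.

(** By this inequality a composite of two interleaving maps shifts at least as far as the direct
    one, as [fix_commute] requires. *)
Lemma le_gap (s t u : time s0 s1) : gap s u <= gap s t + gap t u.
Proof. exact: ler_distD. Qed.

Lemma gapC (s t : time s0 s1) : gap s t = gap t s.
Proof. exact: distrC. Qed.

Lemma fix_interleaving s t (st : before s t) :
  interleaving (fix_alpha st) (fix_beta st).
Proof.
have [ab ba] := vm_interleaving X st.
by split=> h u; apply: val_inj;
  rewrite /= [RHS]val_fix_tr ?ab ?ba // -addrA lerDl addr_ge0 ?gap_ge0.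
Qed.

(** The bound [e <= e1 + e2] makes the transition map in the triangle go upwards, where [fix_tr] is
    the restriction of the original map and not its junk value. *)
Lemma fix_commute (e1 e2 e : R) (A B C : pmod R K)
    (a : pm_hom A A) (b : pm_hom B B) (c : pm_hom C C)
    (al : eps_mor e1 A B) (be : eps_mor e2 B C) (ga : eps_mor e A C)
    (Hal : forall h x, b (h + e1) (al h x) = al h (a h x))
    (Hbe : forall h x, c (h + e2) (be h x) = be h (b h x))
    (Hga : forall h x, c (h + e) (ga h x) = ga h (a h x)) :
  e <= e1 + e2 -> commute_via al be ga ->
  commute_via (fix_em Hal) (fix_em Hbe) (fix_em Hga).
Proof.
move=> ee H h u; apply: val_inj.
by rewrite [RHS]val_fix_tr /= ?H // -addrA lerD2l.
Qed.

Lemma fix_functorial s t u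
    (st : before s t) (tu : before t u) (su : before s u) :
  commute_via (fix_alpha st) (fix_alpha tu) (fix_alpha su) /\
  commute_via (fix_beta tu) (fix_beta st) (fix_beta su).
Proof.
have [aa bb] := vm_functorial X st tu su.
split; apply: fix_commute => //; rewrite ?le_gap //.
by rewrite addrC le_gap.
Qed.

Lemma fix_mixed s t u
    (st : before s t) (tu : before t u) (su : before s u) :
  [/\ commute_via (fix_beta st) (fix_alpha su) (fix_alpha tu),
      commute_via (fix_alpha su) (fix_beta tu) (fix_alpha st),
      commute_via (fix_beta su) (fix_alpha st) (fix_beta tu) &
      commute_via (fix_alpha tu) (fix_beta su) (fix_beta st)].
Proof.
have [H1 H2 H3 H4] := vm_mixed X st tu su.
split; apply: fix_commute => //.
- by rewrite (gapC s t) le_gap.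
- by rewrite (gapC t u) le_gap.
- by rewrite (gapC t u) (gapC s u) le_gap.
- by rewrite (gapC s t) (gapC s u) le_gap.
Qed.

Definition fix_vm : vineyard_module s0 s1 K :=
  VineyardModule fix_interleaving fix_functorial fix_mixed.

End FixedVineyardModule.

(** * Splitting a vineyard module by orthogonal idempotents *)

Section SplitByIdempotents.
Variables (s0 s1 : R) (X : vineyard_module s0 s1 K) (I : finType).
Variable p : I -> vm_hom X X.
Hypothesis p_orth :
  forall i j t h x, p i t h (p j t h x) = if i == j then p j t h x else 0.
Hypothesis p_sum : forall t h x, \sum_i p i t h x = x.

Let Y := vsum (fun i => fix_vm (p i)).

Let sum_val t h (u : Y t h) : X t h := \sum_i val (u i).

Lemma split_linear t h : linear (@sum_val t h).
Proof.
move=> a u v; rewrite /sum_val scaler_sumr -big_split.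
by apply: eq_bigr => i _; rewrite !ffunE.
Qed.

HB.instance Definition _ t h :=
  GRing.isLinear.Build K (Y t h) (X t h) *:%R (@sum_val t h)
    (@split_linear t h).

Lemma split_tr t g h : g <= h -> forall u,
  sum_val (pm_tr (Y t) g h u) = pm_tr (X t) g h (sum_val u).
Proof.
move=> gh u; rewrite /sum_val linear_sum.
by apply: eq_bigr => i _; rewrite !ffunE val_fix_tr.
Qed.

Lemma split_alpha s t (st : before s t) h u :
  sum_val (vm_alpha Y st h u) = vm_alpha X st h (sum_val u).
Proof.
by rewrite /sum_val linear_sum; apply: eq_bigr => i _; rewrite !ffunE.
Qed.

Lemma split_beta s t (st : before s t) h u :
  sum_val (vm_beta Y st h u) = vm_beta X st h (sum_val u).
Proof.
by rewrite /sum_val linear_sum; apply: eq_bigr => i _; rewrite !ffunE.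
Qed.

Definition split_pm_hom t : pm_hom (Y t) (X t) :=
  @PMHom R K (Y t) (X t) (fun h => @sum_val t h) (@split_tr t).

Definition split_vm_hom : vm_hom Y X :=
  @VMHom R s0 s1 K Y X split_pm_hom split_alpha split_beta.

(** By orthogonality [p i] recovers the [i]-th summand from [sum_val u], which gives injectivity. A
    preimage of [x] has the components [p i t h x], which add up to [x]. *)
Lemma vm_iso_split : vm_iso X Y.
Proof.
apply: (@vm_iso_of_bij _ _ _ _ split_vm_hom) => t h.
  have p_sum_val i (u : Y t h) : p i t h (sum_val u) = val (u i).
    rewrite linear_sum (bigD1 i) //= fix_valP big1 ?addr0 // => j ji.
    by rewrite -(fix_valP (u j)) p_orth eq_sym (negbTE ji).
  move=> u v uv; apply/ffunP=> i; apply: val_inj.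
  by rewrite -!p_sum_val; congr (p i t h _).
move=> x.
have px i : p i t h x \in fixed_by (p i t h) by rewrite inE p_orth eqxx.
exists [ffun i => FixSub (px i)]; rewrite /= /sum_val -[RHS]p_sum.
by apply: eq_bigr => i _; rewrite ffunE.
Qed.

End SplitByIdempotents.
End PersistenceModuleLemmas.

(** * Bases *)

Section BasisLemmas.
Variables (K : fieldType) (V : lmodType K) (I : finType).
Variables (P : pred I) (e : I -> V).
Hypothesis eP : is_basis P e.

Lemma basis_coord_inj (c d : I -> K) :
    \sum_(i | P i) c i *: e i = \sum_(i | P i) d i *: e i ->
  forall i, P i -> c i = d i.
Proof.
move=> cd i Pi; apply/eqP; rewrite -subr_eq0; apply/eqP.
apply: (eP.1 (fun i => c i - d i)) => //.
under eq_bigr do rewrite scalerBl.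
by rewrite sumrB cd subrr.
Qed.

(** The chosen coordinates [c v] are arbitrary outside [P], but on [P] they are unique and hence
    linear in [v]; only these enter [f]. *)
Lemma basis_lift (W : lmodType K) (w : I -> W) :
  exists f : {linear V -> W}, forall i, P i -> f (e i) = w i.
Proof.
pose c v := projT1 (cid (eP.2 v)).
have cP v : v = \sum_(i | P i) c v i *: e i := projT2 (cid (eP.2 v)).
pose f v := \sum_(i | P i) c v i *: w i.
have f_lin : linear f.
  move=> a u v; rewrite /f scaler_sumr -big_split /=.
  apply: eq_bigr => i Pi; rewrite scalerA -scalerDl; congr (_ *: _).
  apply: (basis_coord_inj (d := fun i => a * c u i + c v i)) i Pi.
  rewrite -cP [in LHS](cP u) [in LHS](cP v).
  rewrite scaler_sumr -big_split; apply: eq_bigr => j _.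
  by rewrite scalerA scalerDl.
pose L := GRing.isLinear.Build K V W *:%R f f_lin.
pose fL : {linear V -> W} := HB.pack f L.
exists fL => i Pi; rewrite /fL /= /f (bigD1 i) //=.
have ci j : P j -> c (e i) j = (j == i)%:R.
  apply: (basis_coord_inj (d := fun j => (j == i)%:R)); rewrite -cP.
  rewrite (bigD1 i) //= eqxx scale1r big1 ?addr0 // => k /andP[_ /negbTE->].
  by rewrite scale0r.
rewrite ci // eqxx scale1r big1 ?addr0 // => j /andP[Pj /negbTE ji].
by rewrite ci // ji scale0r.
Qed.

Lemma basis_ext (W : lmodType K) (f g : {linear V -> W}) :
  (forall i, P i -> f (e i) = g (e i)) -> f =1 g.
Proof.
move=> fg v; have [c ->] := eP.2 v; rewrite !linear_sum.
by apply: eq_bigr => i Pi; rewrite !linearZ /= fg.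
Qed.

End BasisLemmas.

Lemma sum_reindex_inj (A : nmodType) (I J : finType) (f : J -> I)
    (P : pred I) (F : I -> A) :
    injective f -> (forall i, P i -> exists j, f j = i) ->
  \sum_(i | P i) F i = \sum_(j | P (f j)) F (f j).
Proof.
(* The partial inverse of [f] that [reindex_omap] asks for. *)
move=> f_inj f_surj; pose f' i := [pick j | f j == i].
have fK j : f' (f j) = Some j.
  rewrite /f'; case: pickP => [k /eqP/f_inj-> //|/(_ j)].
  by rewrite eqxx.
rewrite (reindex_omap f f').
  by apply: eq_bigl => j; rewrite fK eqxx andbT.
by move=> i /f_surj[j <-]; rewrite fK.
Qed.

(** Extending the coefficients by zero outside the image of [f] turns a relation in the subfamily
    into one in the whole basis. *)
Lemma free_reindex (K : fieldType) (V : lmodType K) (I J : finType)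
    (f : J -> I) (P : pred I) (e : I -> V) :
    injective f -> is_basis P e ->
  forall c : J -> K, \sum_(j | P (f j)) c j *: e (f j) = 0 ->
    forall j, P (f j) -> c j = 0.
Proof.
move=> f_inj eP c c0 j Pj.
pose d i := if [pick k | f k == i] is Some k then c k else 0.
have dE k : d (f k) = c k.
  rewrite /d; case: pickP => [l /eqP/f_inj-> //|/(_ k)].
  by rewrite eqxx.
rewrite -dE; apply: eP.1 => //; rewrite -[RHS]c0.
rewrite (bigID [pred i in codom f]) /= [X in _ + X]big1 ?addr0.
  rewrite (sum_reindex_inj _ f_inj) /=.
    by apply: eq_big => k; rewrite ?codom_f ?andbT // dE.
  by move=> i /andP[_ /codomP[k ->]]; exists k.
move=> i /andP[_ fi]; rewrite /d; case: pickP => [k /eqP fk|]; last first.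
  by rewrite scale0r.
by rewrite -fk codom_f in fi.
Qed.

(** A diagram obtained by [pmap] forgets which vine each point came from; [f] recovers it, through
    the equally long list [l] of indices where [D] is defined. *)
Lemma pmap_index (T : eqType) (N : nat) (D : 'I_N -> option T) :
  let s := pmap D (enum 'I_N) in
  exists f : 'I_(size s) -> 'I_N, [/\ injective f,
    forall k, D (f k) = Some (tnth (in_tuple s) k) &
    forall i, D i -> exists k, f k = i].
Proof.
move=> s; pose l := [seq i <- enum 'I_N | D i].
have sl : map some s = map D l by rewrite /s pmapS_filter.
have size_sl : size s = size l by rewrite -(size_map some) sl size_map.
exists (fun k => tnth (in_tuple l) (cast_ord size_sl k)); split.
- move=> j k jk; apply: (@cast_ord_inj _ _ size_sl).
  apply: (tuple_uniqP _ _) jk.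
  exact/filter_uniq/enum_uniq.
- move=> k; have i0 := tnth (in_tuple l) (cast_ord size_sl k).
  have lk : (k < size l)%N by rewrite -size_sl.
  rewrite (tnth_nth i0) /= -(nth_map i0 None D lk) -sl.
  rewrite (nth_map (tnth (in_tuple s) k)) //.
  exact: (congr1 Some (esym (tnth_nth _ (in_tuple s) k))).
- move=> i Di; have il : i \in l by rewrite mem_filter Di mem_enum.
  have lt_i : (index i l < size s)%N by rewrite size_sl index_mem.
  by exists (Ordinal lt_i); rewrite (tnth_nth i) /= nth_index.
Qed.

(** * Images under transition maps and coordinates in interval modules *)

Section PushLemmas.
Variables (R : realType) (K : fieldType).

Lemma push_tr (X : pmod R K) (x : elt X) g h : tag x <= g -> g <= h ->
  pm_tr X g h (push x g) = push x h.
Proof. by move=> xg gh; rewrite /push pm_tr_comp. Qed.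

Lemma push_null (X : pmod R K) (x : elt X) h : tagged x = 0 -> push x h = 0.
Proof. by rewrite /push => ->; rewrite linear0. Qed.

Section IntervalValue.
Variable p : dpoint R.

(** The single coordinate of a vector in an interval module. As a sum it makes sense in dimension 1
    and, being empty, is 0 in dimension 0. *)
Definition itv_val h (u : itv_mod K p h) : K^o := \sum_a u 0 a.

Lemma itv_val_linear h : linear (@itv_val h).
Proof.
move=> a u v; rewrite /itv_val scaler_sumr -big_split.
by apply: eq_bigr => i _; rewrite !mxE.
Qed.

HB.instance Definition _ h := GRing.isLinear.Build K (itv_mod K p h) K^o *:%R
  (@itv_val h) (@itv_val_linear h).

Lemma itv_val_out h (u : itv_mod K p h) : ~~ Defs.in_itv p h -> itv_val u = 0.
Proof.
rewrite /itv_val /=; move: u; rewrite /=.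
by case: Defs.in_itv => // u _; rewrite big_ord0.
Qed.

Lemma itv_val_inj h : injective (@itv_val h).
Proof.
rewrite /itv_val => /= u v; move: u v; rewrite /=.
case: Defs.in_itv => u v; last by move=> _; apply/matrixP=> i [].
by rewrite !big_ord1 => uv; apply/matrixP=> i j; rewrite !ord1.
Qed.

Lemma itv_val_tr g h (u : itv_mod K p g) :
    Defs.in_itv p g -> Defs.in_itv p h ->
  itv_val (pm_tr (itv_mod K p) g h u) = itv_val u.
Proof.
rewrite /itv_val /= /itv_tr; move: u; rewrite /=.
case: (Defs.in_itv p g) => // u _; case: (Defs.in_itv p h) => // _.
by rewrite !big_ord1 mxE big_ord1 mxE mulr1.
Qed.

Lemma itv_val_surj h c : Defs.in_itv p h ->
  exists u : itv_mod K p h, itv_val u = c.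
Proof.
rewrite /itv_val /=; case: Defs.in_itv => // _.
by exists (const_mx c); rewrite big_ord1 mxE.
Qed.

End IntervalValue.

Lemma alive_ge (X : pmod R K) (x : elt X) h : alive x h -> tag x <= h.
Proof. by case/andP. Qed.

(** As [death] is an infimum, a vector of an arbitrary persistence module may still be nonzero at
    its death height; [push_dead] excludes this when there is a diagram. *)
Definition dies (X : pmod R K) (I : Type) (x : I -> elt X) :=
  forall i h, tag (x i) <= h -> ~~ alive (x i) h -> push (x i) h = 0.

(* Intervals are open at their right ends, so the infimum defining [death] is
   attained when it is finite. *)
Lemma push_dead (X : pmod R K) (D : seq (dpoint R)) (x : elt X) h :
  has_diagram X D -> tag x <= h -> ~~ alive x h -> push x h = 0.
Proof.
move=> [_ _ [f [g [fK _]]]] xh; rewrite /alive xh /= -leNgt => dh.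
rewrite -[push x h]fK -[RHS](linear0 (g h)); congr (g h _).
apply/ffunP=> i; apply/eqP; apply/negP => /negP f0; rewrite ffunE in f0.
set p := tnth (in_tuple D) i in f0.
have ih : Defs.in_itv p h.
  apply: contraT => nh; case/eqP: f0; apply: itv_val_inj.
  by rewrite itv_val_out // linear0.
have [b_h h_d] := andP ih.
(* As [death x <= h < p.2], the vector is already zero at some [k] before the right end. The
   transition map from [h] to [k] is injective on this interval, so the coordinate is zero at [h]
   too. *)
have /ereal_inf_lt[_ [k [xk k0] <-] kd] : (death x < p.2)%E.
  exact: le_lt_trans h_d.
have hk : h <= k.
  rewrite leNgt; apply/negP => kh; case/negP: f0.
  by rewrite -(push_tr (ltW xk) (ltW kh)) k0 !linear0 ffunE.
have ik : Defs.in_itv p k by rewrite /Defs.in_itv (le_trans b_h).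
have fk : pm_tr (itv_mod K p) h k (f h (push x h) i) = 0.
  have /ffunP/(_ i) := pm_map_tr f hk (push x h).
  by rewrite push_tr // k0 linear0 !ffunE => /esym.
case/eqP: f0; apply: itv_val_inj.
by rewrite -(itv_val_tr _ ih ik) fk !linear0.
Qed.

End PushLemmas.

(** * Interval decomposition from an extended basis *)

Section DiagramOfBasis.
Variables (R : realType) (K : fieldType) (X : pmod R K) (N : nat).
Variables (D : 'I_N -> option (dpoint R)) (x : 'I_N -> elt X).
Hypothesis xB : extended_basis D x.
Hypothesis x_dead : dies x.

(** Mapping the generator of each interval module to its basis element gives a bijection at every
    height. It commutes with the transition maps past the right end of an interval because of
    [dies]. *)
Lemma has_diagram_of_basis :
    (forall i p, D i = Some p -> (p.1%:E < p.2)%E) ->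
    uniq (pmap D (enum 'I_N)) ->
  has_diagram X (pmap D (enum 'I_N)).
Proof.
move=> D_pos D_uniq; split=> //.
  by move=> p; rewrite mem_pmap => /mapP[i _ /esym/D_pos].
have [f [f_inj Df f_surj]] := pmap_index D.
set s := pmap D _ in f f_inj Df f_surj *.
pose J k := tnth (in_tuple s) k; pose Y := psum (fun k => itv_mod K (J k)).
have tag_x k : tag (x (f k)) = (J k).1.
  by have := xB.1 (f k); rewrite Df => -[[]].
have death_x k : death (x (f k)) = (J k).2.
  by have := xB.1 (f k); rewrite Df => -[].
have aliveE k h : alive (x (f k)) h = Defs.in_itv (J k) h.
  by rewrite /alive tag_x death_x.
have D_aliveE k h : D (f k) && alive (x (f k)) h = Defs.in_itv (J k) h.
  by rewrite Df aliveE.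
(* Below the birth height [push] is unconstrained, but there its coefficient is 0. *)
pose phi h (u : Y h) : X h := \sum_k itv_val (u k) *: push (x (f k)) h.
have phi_lin h : linear (phi h).
  move=> a u v; rewrite /phi scaler_sumr -big_split; apply: eq_bigr => k _.
  by rewrite !ffunE linearP scalerDl scalerA.
pose phiL h : {linear Y h -> X h} :=
  HB.pack (phi h) (GRing.isLinear.Build K (Y h) (X h) *:%R (phi h) (phi_lin h)).
have phi_tr g h : g <= h ->
    forall u, phiL h (pm_tr Y g h u) = pm_tr X g h (phiL g u).
  move=> gh u; rewrite [RHS]linear_sum; apply: eq_bigr => k _.
  rewrite ffunE [RHS]linearZZ.
  have /orP[kg|kg] := orbN (Defs.in_itv (J k) g); last first.
    rewrite (itv_val_out _ kg) scale0r (_ : u k = 0) ?linear0 ?scale0r //.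
    by apply: itv_val_inj; rewrite itv_val_out ?linear0.
  have xg : tag (x (f k)) <= g by rewrite tag_x; case/andP: kg.
  rewrite push_tr //.
  have /orP[kh|kh] := orbN (Defs.in_itv (J k) h).
    by rewrite (itv_val_tr (u k) kg kh).
  by rewrite x_dead ?scaler0 ?aliveE // (le_trans xg).
have phiE h (u : Y h) :
    phiL h u = \sum_(k | Defs.in_itv (J k) h) itv_val (u k) *: push (x (f k)) h.
  rewrite /= /phi (bigID (fun k => Defs.in_itv (J k) h)) /=.
  rewrite [X in _ + X]big1 ?addr0 // => k kh.
  by rewrite itv_val_out ?scale0r.
have [] := @pm_iso_of_bij _ _ X Y (PMHom phi_tr).
- move=> h; apply: raddf_inj => u; rewrite [X in X = 0]phiE => u0.
  have uk0 k : Defs.in_itv (J k) h -> itv_val (u k) = 0.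
    rewrite -D_aliveE => Dk.
    apply: (free_reindex f_inj (xB.2 h) (c := fun k => itv_val (u k))) => //.
    by rewrite -[RHS]u0; apply: eq_bigl => l; rewrite D_aliveE.
  apply/ffunP=> k; rewrite ffunE; apply: itv_val_inj; rewrite linear0.
  by have /orP[/uk0|/itv_val_out->] := orbN (Defs.in_itv (J k) h).
- move=> h y; have [c ->] := (xB.2 h).2 y.
  have uP k : exists u : itv_mod K (J k) h,
      Defs.in_itv (J k) h -> itv_val u = c (f k).
    have /orP[kh|/negP kh] := orbN (Defs.in_itv (J k) h); last by exists 0.
    by have [u <-] := itv_val_surj (c (f k)) kh; exists u.
  exists [ffun k => projT1 (cid (uP k))]; rewrite [LHS]phiE.
  rewrite (sum_reindex_inj _ f_inj); last by move=> i /andP[/f_surj].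
  apply: eq_big => k; rewrite ?D_aliveE // => kh.
  by rewrite ffunE; congr (_ *: _); apply: (projT2 (cid (uP k))).
by move=> g [gK phiK]; exists g, (PMHom phi_tr); split=> h u; rewrite ?gK ?phiK.
Qed.

End DiagramOfBasis.

(** * Diagrams of subfamilies of vines *)

Section Subsequences.

Lemma pmap_filter_subseq (S T : eqType) (f : S -> option T) (a : pred S) s :
  subseq (pmap f [seq x <- s | a x]) (pmap f s).
Proof.
elim: s => //= y s IH; case: (a y) => /=; case: (f y) => [z|] //=.
  by rewrite eqxx.
exact: subseq_trans IH (subseq_cons _ _).
Qed.

Lemma subseq_embedding (T : eqType) (v w : seq T) : subseq v w ->
  exists f : 'I_(size v) -> 'I_(size w),
    {homo f : i j / (i < j)%N} /\
    forall i, tnth (in_tuple w) (f i) = tnth (in_tuple v) i.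
Proof.
(* The empty case is split off because [nth] below needs a default value. *)
case: v => [|y0 v0].
  by exists (fun i : 'I_0 => False_rect _ (notF (ltn_ord i))); split=> -[].
move: (y0 :: v0) => v vw.
(* Positions are treated as natural numbers, which keeps the bounds of ordinals out of the
   induction. *)
suff [f [f_homo f_lt f_nth]] : exists f : nat -> nat,
    [/\ {homo f : i j / (i < j)%N},
        forall i, (i < size v)%N -> (f i < size w)%N &
        forall i, (i < size v)%N -> nth y0 w (f i) = nth y0 v i].
  exists (fun i : 'I_(size v) => Ordinal (f_lt i (ltn_ord i))).
  split=> [i j /f_homo //|i].
  by rewrite !(tnth_nth y0) /= f_nth.
elim: w v vw => [|z w IH] [|y v] //=; try by exists id; split.
case: eqP => [<-|_] /IH[f [f_homo f_lt f_nth]].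
  exists (fun i => if i is j.+1 then (f j).+1 else 0%N).
  split=> [[|i] [|j] //= ij|[|i] // /f_lt|[|i] // /f_nth] //.
  exact: (f_homo i j).
exists (fun i => (f i).+1); split=> [i j /f_homo|i /f_lt|i /f_nth] //.
Qed.

(** A strictly increasing embedding of positions maps coinciding pairs injectively to coinciding
    pairs. *)
Lemma coincidences_subseq (R : realType) (v w : seq (\bar R)) :
  subseq v w -> (#|coincidences v| <= #|coincidences w|)%N.
Proof.
move=> /subseq_embedding[f [f_homo f_nth]].
have f_inj : injective f.
  move=> i j ij; apply/eqP; rewrite -val_eqE /=; apply: contraT.
  by rewrite neq_ltn => /orP[] /f_homo; rewrite ij ltnn.
rewrite -(card_imset _ (f := fun ij => (f ij.1, f ij.2))); last first.
  by move=> [i j] [k l] [/f_inj-> /f_inj->].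
apply/subset_leq_card/fintype.subsetP => _ /imsetP[[i j] + ->].
by rewrite !inE /= => /andP[/f_homo-> ij]; rewrite !f_nth.
Qed.

Lemma critical_values_subseq (R : realType) (D E : seq (dpoint R)) :
  subseq D E -> subseq (critical_values D) (critical_values E).
Proof.
move=> DE; apply: cat_subseq; apply: map_subseq => //.
by rewrite subseq_filter filter_all (subseq_trans (filter_subseq _ _)).
Qed.

Lemma pmap_enum_val (T : Type) (N : nat) (S : {set 'I_N})
    (D : 'I_N -> option T) :
  pmap (fun i : 'I_#|S| => D (enum_val i)) (enum 'I_#|S|) = pmap D (enum S).
Proof.
have -> : enum S = map enum_val (enum 'I_#|S|).
  (* An index [i0] serves as default for [nth]; for empty [S] both lists are empty. *)
  case: (pickP [in S]) => [i0 _|S0].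
    apply: (@eq_from_nth _ i0) => [|i iS].
      by rewrite size_map size_enum_ord cardE.
    rewrite -cardE in iS.
    rewrite (nth_map (Ordinal iS)) ?size_enum_ord //.
    by rewrite (enum_val_nth i0) nth_enum_ord.
  rewrite (eq_enum S0) enum0; case: (enum _) => // k l.
  by have := S0 (enum_val k); rewrite /= enum_valP.
by elim: (enum _) => //= i l ->; case: (D _).
Qed.

Lemma vines_diagram_subseq (R : realType) (s0 s1 : R) (N : nat)
    (gamma : 'I_N -> vine s0 s1) (S : {set 'I_N}) t :
  subseq (vines_diagram (fun i : 'I_#|S| => gamma (enum_val i)) t)
         (vines_diagram gamma t).
Proof.
rewrite /vines_diagram (pmap_enum_val S (fun i => gamma i t)).
have -> : enum S = [seq i <- enum 'I_N | i \in S].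
  by rewrite enumT; apply: eq_filter.
exact: pmap_filter_subseq.
Qed.

End Subsequences.

(** * Projections along a block *)

Section BasisProjection.
Variables (R : realType) (K : fieldType) (N : nat) (S : {set 'I_N}).

(** Heights past the death and zero elements are included, so that uses need no case distinction on
    [alive]. *)
Definition is_projection (X : pmod R K) (x : 'I_N -> elt X) (p : pm_hom X X) :=
  forall i h, tag (x i) <= h ->
    p h (push (x i) h) = if i \in S then push (x i) h else 0.

Lemma projection_exists (X : pmod R K) (D : 'I_N -> option (dpoint R))
    (x : 'I_N -> elt X) :
  extended_basis D x -> dies x -> exists p, is_projection x p.
Proof.
move=> [xD xB] x_dead.
pose q h := cid (basis_lift (xB h)
  (fun i => if i \in S then push (x i) h else 0)).
pose p h := projT1 (q h).
have pP i h : tag (x i) <= h ->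
    p h (push (x i) h) = if i \in S then push (x i) h else 0.
  move=> xh; have /orP[/(projT2 (q h) i)//|] := orbN (D i && alive (x i) h).
  (* An index outside the basis at height [h] carries a zero element or a dead one. *)
  suff x0 : ~~ (D i && alive (x i) h) -> push (x i) h = 0.
    by move=> /x0->; rewrite linear0 if_same.
  rewrite negb_and => /orP[Di|]; last exact: x_dead.
  by apply: push_null; have := xD i; case: (D i) Di.
have p_tr g h : g <= h ->
    forall v, p h (pm_tr X g h v) = pm_tr X g h (p g v).
  move=> gh; apply: (basis_ext (xB g) (f := p h \o pm_tr X g h)
    (g := pm_tr X g h \o p g)) => i /andP[_ /alive_ge xg] /=.
  rewrite push_tr // !pP ?(le_trans xg) //.
  by case: ifP; rewrite ?linear0 ?push_tr.
by exists (PMHom p_tr).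
Qed.

(** Block diagonality for [S] and its complement, which is all that the projection to one block
    sees. *)
Definition separates (A : 'M[K]_N) :=
  forall i j, (i \in S) != (j \in S) -> A i j = 0.

(** The matrix describes [al] only at the heights [tag (x i)], so a basis vector at height [h] is
    traced back to there. Its column is supported on one side of [S], so [q] fixes or kills the
    whole image. *)
Lemma em_projection (e : R) (X Y : pmod R K) (D : 'I_N -> option (dpoint R))
    (x : 'I_N -> elt X) (y : 'I_N -> elt Y) (al : eps_mor e X Y) (A : 'M[K]_N)
    (p : pm_hom X X) (q : pm_hom Y Y) :
    extended_basis D x -> is_Mat x y al A -> separates A ->
    is_projection x p -> is_projection y q ->
  forall h v, q (h + e) (al h v) = al h (p h v).
Proof.
move=> [_ xB] [alE A0] sepA px qy h.
apply: (basis_ext (xB h) (f := q (h + e) \o al h) (g := al h \o p h)).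
move=> i /andP[_ /alive_ge xh] /=; rewrite px //.
have xhe : tag (x i) + e <= h + e by rewrite lerD2r.
have -> : push (x i) h = pm_tr X (tag (x i)) h (tagged (x i)) by [].
rewrite (fun_if (al h)) linear0 em_map_tr // alE !linear_sum.
have yE j : alive (y j) (tag (x i) + e) -> q (h + e) (pm_tr Y (tag (x i) + e)
    (h + e) (A j i *: push (y j) (tag (x i) + e))) =
    A j i *: if j \in S then push (y j) (h + e) else 0.
  move=> /alive_ge yj; rewrite !linearZZ push_tr // qy //.
  exact: le_trans xhe.
case: ifP => iS; last apply: big1; last first.
  move=> j /and3P[_ _ yj]; rewrite yE //.
  case: ifP => jS; last by rewrite scaler0.
  by rewrite sepA ?scale0r // jS iS.
apply: eq_bigr => j /and3P[_ _ yj]; rewrite yE //.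
rewrite linearZZ push_tr ?alive_ge //.
by case: ifP => // jS; rewrite sepA ?scale0r // iS jS.
Qed.

End BasisProjection.

(** * Extended bases and matrices of fixed submodules *)

Section FixedBasis.
Variables (R : realType) (K : fieldType) (X : pmod R K) (p : pm_hom X X).

Section Element.
Variable x : elt X.
Hypothesis px : tagged x \in fixed_by (p (tag x)).

Definition fix_elt : elt (fix_pmod p) :=
  @existT R (fun h => fix_pmod p h) (tag x) (FixSub px).

Lemma val_push h : tag x <= h -> val (push fix_elt h) = push x h.
Proof. exact: val_fix_tr. Qed.

Lemma fix_eq0 h (u : fix_pmod p h) : (u == 0) = (val u == 0).
Proof. by rewrite -(inj_eq val_inj). Qed.

Lemma death_fix : death fix_elt = death x.
Proof.
rewrite /death; congr (ereal_inf (image _ _)); apply/seteqP.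
split=> g /= [xg] /eqP g0; split=> //; apply/eqP.
  by rewrite -val_push ?ltW // -fix_eq0.
by rewrite fix_eq0 val_push ?ltW.
Qed.

Lemma alive_fix h : alive fix_elt h = alive x h.
Proof. by rewrite /alive death_fix. Qed.

(** An earlier preimage among the fixed points would also be one in [X]. *)
Lemma has_birth_fix b : has_birth x b -> has_birth fix_elt b.
Proof.
move=> [xb x_new]; split=> // g gx [u ux]; apply: (x_new g gx).
by exists (val u); rewrite -(val_fix_tr _ (ltW gx)) ux.
Qed.

End Element.

Variables (N : nat) (S : {set 'I_N}) (D : 'I_N -> option (dpoint R)).
Variable x : 'I_N -> elt X.
Hypotheses (xD : extended_basis D x) (x_dead : dies x).
Hypothesis px : is_projection S x p.

Lemma fix_basis_subproof (i : 'I_#|S|) :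
  tagged (x (enum_val i)) \in fixed_by (p (tag (x (enum_val i)))).
Proof.
have := px (lexx (tag (x (enum_val i)))).
by rewrite /push pm_tr_id enum_valP inE => ->.
Qed.

Definition fix_basis i := fix_elt (fix_basis_subproof i).

Lemma enum_val_surj (i : 'I_N) : i \in S -> exists j : 'I_#|S|, enum_val j = i.
Proof. by move=> iS; exists (enum_rank_in iS i); rewrite enum_rankK_in. Qed.

(** For spanning, a fixed vector is expanded in the basis of [X]; applying [p] leaves the vector
    unchanged and removes the terms outside [S]. *)
Lemma fix_extended_basis :
  extended_basis (fun i => D (enum_val i)) fix_basis.
Proof.
split=> [i|h].
  have := xD.1 (enum_val i); case: (D _) => [q [? ?]|x0].
    by split; [exact: has_birth_fix|rewrite death_fix].
  exact: val_inj.
have aliveE i : alive (fix_basis i) h = alive (x (enum_val i)) h.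
  exact: alive_fix.
have sumE (c : 'I_#|S| -> K) :
    val (\sum_(i | D (enum_val i) && alive (fix_basis i) h)
           c i *: push (fix_basis i) h : fix_pmod p h) =
    \sum_(i | D (enum_val i) && alive (x (enum_val i)) h)
       c i *: push (x (enum_val i)) h.
  rewrite linear_sum; apply: eq_big => i; first by rewrite aliveE.
  move=> /andP[_ /alive_ge xh].
  by rewrite linearZZ; congr (_ *: _); apply: val_push.
split=> [c c0 i|v].
  rewrite aliveE; apply: (free_reindex (@enum_val_inj _ _) (xD.2 h)).
  by rewrite -sumE c0.
have [c vE] := (xD.2 h).2 (val v); exists (c \o enum_val).
apply: val_inj; rewrite sumE -(fix_valP v) vE linear_sum /=.
rewrite (bigID [pred i in S]) /= [X in _ + X]big1 ?addr0; last first.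
  move=> i /andP[/andP[_ /alive_ge xh] /negbTE iS].
  by rewrite linearZZ px // iS scaler0.
rewrite (sum_reindex_inj _ (@enum_val_inj _ (mem S))) /=.
  apply: eq_big => i; first by rewrite enum_valP andbT.
  by move=> /andP[/andP[_ /alive_ge xh] iS]; rewrite linearZZ px // iS.
by move=> i /andP[_ /enum_val_surj].
Qed.

Lemma fix_basis_dies : dies fix_basis.
Proof.
move=> i h xh; rewrite alive_fix => xi; apply: val_inj.
by rewrite val_push // x_dead.
Qed.

End FixedBasis.

(** A column indexed by [S] vanishes in the rows outside [S], so restricting the rows loses no term
    of the expansion. *)
Lemma is_Mat_fix (R : realType) (K : fieldType) (N : nat) (S : {set 'I_N})
    (e : R) (X Y : pmod R K) (x : 'I_N -> elt X) (y : 'I_N -> elt Y)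
    (al : eps_mor e X Y) (A : 'M[K]_N) (p : pm_hom X X) (q : pm_hom Y Y)
    (px : is_projection S x p) (qy : is_projection S y q)
    (qal : forall h v, q (h + e) (al h v) = al h (p h v)) :
    is_Mat x y al A -> separates S A ->
  is_Mat (fix_basis px) (fix_basis qy) (fix_em qal) (restrict_mx S A).
Proof.
move=> [alE A0] sepA.
have entryE i j :
    [&& tagged (fix_basis px i) != 0, tagged (fix_basis qy j) != 0
      & alive (fix_basis qy j) (tag (fix_basis px i) + e)] =
    [&& tagged (x (enum_val i)) != 0, tagged (y (enum_val j)) != 0
      & alive (y (enum_val j)) (tag (x (enum_val i)) + e)].
  by rewrite !fix_eq0 alive_fix.
split=> [i|j i]; last by rewrite entryE mxE; apply: A0.
apply: val_inj; rewrite [LHS]alE linear_sum.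
rewrite (bigID (fun j => j \in S)) [X in _ + X = _]big1 ?addr0; last first.
  move=> j /andP[_ /negbTE jS].
  by rewrite sepA ?scale0r // jS enum_valP.
rewrite (sum_reindex_inj _ (@enum_val_inj _ (mem S))); last first.
  by move=> j /andP[_ /enum_val_surj].
apply: eq_big => j; first by rewrite enum_valP andbT entryE.
move=> /andP[/and3P[_ _ /alive_ge yj] _].
by rewrite linearZZ mxE; congr (_ *: _); apply/esym/val_push.
Qed.

(** * Partitions of the vines into blocks *)

Section Partition.
Variables (N m : nat) (S : 'I_m -> {set 'I_N}).
Hypothesis S_inj : injective S.
Hypothesis S_part :
  finset.partition [set S j | j : 'I_m]%SET [set: 'I_N]%SET.

Lemma part_mem i : exists j, i \in S j.
Proof.
have: i \in finset.cover [set S j | j : 'I_m]%SET.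
  by rewrite (finset.cover_partition S_part) finset.in_setT.
by case/finset.bigcupP=> _ /imsetP[j _ ->] iS; exists j.
Qed.

(** The partition is a set of blocks and forgets repetitions; disjointness shows that the blocks
    agree, and injectivity of [S] that their indices do. *)
Lemma part_uniq i j k : i \in S j -> i \in S k -> j = k.
Proof.
have /and3P[_ /finset.trivIsetP tI _] := S_part.
move=> ij ik; apply: S_inj; apply/eqP; apply: contraT => jk.
have SI l : S l \in [set S l | l : 'I_m]%SET by apply: imset_f.
by have /disjoint_setI0/setP/(_ i) := tI _ _ (SI j) (SI k) jk;
  rewrite !finset.inE ij ik.
Qed.

Lemma block_separates (K : fieldType) (A : 'M[K]_N) j :
  block_diagonal S A -> separates (S j) A.
Proof.
move=> A_block i1 i2 ne; have [k1 i1k] := part_mem i1.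
have [k2 i2k] := part_mem i2; apply: (A_block k1 k2) => //.
apply: contraNneq ne => k12; rewrite -k12 in i2k; apply/eqP.
by apply/idP/idP => [/part_uniq/(_ i1k)->|/part_uniq/(_ i2k)->].
Qed.

End Partition.

(** * Decomposition of the vineyard module along the blocks *)

Section BlockDecomposition.
Variables (R : realType) (K : fieldType) (s0 s1 : R).
Variables (X : vineyard_module s0 s1 K) (N : nat).
Variables (D : time s0 s1 -> 'I_N -> option (dpoint R)).
Variables (B : forall t, 'I_N -> elt (X t)).
Hypothesis B_basis : forall t, extended_basis (D t) (B t).
Hypothesis B_dies : forall t, dies (B t).

Lemma vm_projection_exists (S : {set 'I_N})
    (Malpha Mbeta : time s0 s1 -> time s0 s1 -> 'M[K]_N) :
    (forall s t (st : before s t),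
       is_Mat (B s) (B t) (vm_alpha X st) (Malpha s t) /\
       is_Mat (B t) (B s) (vm_beta X st) (Mbeta s t)) ->
    (forall s t, before s t ->
       separates S (Malpha s t) /\ separates S (Mbeta s t)) ->
  exists p : vm_hom X X, forall t, is_projection S (B t) (p t).
Proof.
move=> M_Mat M_sep.
pose q t := cid (projection_exists S (B_basis t) (@B_dies t)).
pose p t := projT1 (q t).
have pP t : is_projection S (B t) (p t) := projT2 (q t).
have p_alpha s t (st : before s t) h v :
    p t (h + gap s t) (vm_alpha X st h v) = vm_alpha X st h (p s h v).
  exact: (em_projection (B_basis s) (M_Mat s t st).1 (M_sep s t st).1).
have p_beta s t (st : before s t) h v :
    p s (h + gap s t) (vm_beta X st h v) = vm_beta X st h (p t h v).
  exact: (em_projection (B_basis t) (M_Mat s t st).2 (M_sep s t st).2).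
by exists (VMHom p_alpha p_beta).
Qed.

(** Orthogonality and the sum being the identity are checked on basis vectors, where exactly one
    projection acts as the identity and the others vanish. *)
Lemma vm_iso_projections (m : nat) (S : 'I_m -> {set 'I_N})
    (p : 'I_m -> vm_hom X X) :
    (forall i, exists j, i \in S j) ->
    (forall i j k, i \in S j -> i \in S k -> j = k) ->
    (forall j t, is_projection (S j) (B t) (p j t)) ->
  vm_iso X (vsum (fun j => fix_vm (p j))).
Proof.
move=> S_cover S_disj pP; apply: vm_iso_split => [i j t h|t h x].
  have [->|ij] := eqVneq i j.
    apply: (basis_ext ((B_basis t).2 h) (f := p j t h \o p j t h)
      (g := p j t h)).
    move=> k /andP[_ /alive_ge kh] /=; rewrite !pP //.
    by case: ifP => kj; rewrite ?linear0 // pP // kj.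
  apply: (basis_ext ((B_basis t).2 h) (f := p i t h \o p j t h) (g := \0)).
  move=> k /andP[_ /alive_ge kh] /=; rewrite pP //.
  case: ifP => kj; rewrite ?linear0 // pP // ifN //.
  by apply: contraNN ij => ki; rewrite (S_disj k i j).
have [c ->] := ((B_basis t).2 h).2 x.
under eq_bigr do rewrite linear_sum.
rewrite exchange_big; apply: eq_bigr => k /andP[_ /alive_ge kh].
have [j kj] := S_cover k; rewrite (bigD1 j) //= big1 ?addr0.
  by rewrite linearZZ pP // kj.
move=> i ij; rewrite linearZZ pP // ifN ?scaler0 //.
by apply: contraNN ij => ki; rewrite (S_disj k i j).
Qed.

End BlockDecomposition.

(** The diagram comes from the restricted basis. Genericity is inherited because the critical values
    of the block form a subsequence of all critical values. *)
Lemma has_vines_fix (R : realType) (K : fieldType) (s0 s1 : R)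
    (X : vineyard_module s0 s1 K) (N : nat) (gamma : 'I_N -> vine s0 s1)
    (B : forall t, 'I_N -> elt (X t)) (S : {set 'I_N}) (p : vm_hom X X) :
    has_vines X gamma ->
    (forall t, extended_basis (fun i => gamma i t) (B t)) ->
    (forall t, dies (B t)) ->
    (forall t, is_projection S (B t) (p t)) ->
  has_vines (fix_vm p) (fun i : 'I_#|S| => gamma (enum_val i)).
Proof.
move=> [X_diag X_fin X_gen] B_basis B_dies pP.
have sub t := vines_diagram_subseq gamma S t.
split=> [t||t].
- apply: (has_diagram_of_basis (fix_extended_basis (B_basis t) (pP t))).
  + exact: fix_basis_dies.
  + by move=> i q; apply: vine_off_diagonal.
  + by have [_ + _] := X_diag t; apply: subseq_uniq (sub t).
- apply: sub_finite_set X_fin => t /=; apply: contraNN.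
  exact/subseq_uniq/critical_values_subseq.
- exact: leq_trans (coincidences_subseq (critical_values_subseq (sub t))) _.
Qed.

Theorem lemma5p3 (R : realType) (K : fieldType) (s0 s1 : R) (hs : s0 <= s1)
    (X : vineyard_module s0 s1 K) (N : nat) (gamma : 'I_N -> vine s0 s1)
    (Malpha Mbeta : time s0 s1 -> time s0 s1 -> 'M[K]_N)
    (hX : vine_matrix_rep X gamma Malpha Mbeta)
    (m : nat) (S : 'I_m -> {set 'I_N})
    (hSinj : injective S)
    (hS : finset.partition [set S j | j : 'I_m]%SET [set: 'I_N]%SET)
    (hblock : forall s t, before s t ->
       block_diagonal S (Malpha s t) /\ block_diagonal S (Mbeta s t)) :
  exists Xs : 'I_m -> vineyard_module s0 s1 K,
    vm_iso X (vsum Xs) /\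
    forall j, vine_matrix_rep (Xs j)
      (fun i : 'I_#|S j| => gamma (enum_val i))
      (fun s t => restrict_mx (S j) (Malpha s t))
      (fun s t => restrict_mx (S j) (Mbeta s t)).
Proof.
have [X_vines [B [B_basis B_Mat]]] := hX.
(* Here the interval decomposition of each [X t] enters. *)
have B_dies t : dies (B t).
  by move=> i h; apply: push_dead; have [] := X_vines.
have M_sep j s t (st : before s t) :
    separates (S j) (Malpha s t) /\ separates (S j) (Mbeta s t).
  have [a_block b_block] := hblock s t st.
  by split; apply: (block_separates hSinj hS).
pose q j := cid (vm_projection_exists B_basis B_dies B_Mat (M_sep j)).
pose p j := projT1 (q j).
have pP j t : is_projection (S j) (B t) (p j t) := projT2 (q j) t.
exists (fun j => fix_vm (p j)); split=> [|j].
  apply: (vm_iso_projections B_basis _ _ pP); first exact: part_mem hS.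
  exact: part_uniq hSinj hS.
split; first exact: has_vines_fix (pP j).
exists (fun t => fix_basis (pP j t)); split=> [t|s t st].
  exact: (fix_extended_basis (B_basis t)).
have [a_sep b_sep] := M_sep j s t st; have [a_Mat b_Mat] := B_Mat s t st.
by split; apply: is_Mat_fix.
Qed.
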